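(* Let $n\ge 1$ be an integer, let $i_1,\dots,i_n$ be independent real random variables with $E(1+i_l)=1+j$ and $Var(1+i_l)=s^2$ for every $l$, where $j\in\mathbb{R}\setminus\{0,-1\}$, and let $1\le k\le n$. Let $C_k$ be the final value of the increasing annuity-due with $k$ annual payments $1,2,\dots,k$. Then $$E(C_k)=(I\ddot s)_{\overline{k}|j},$$ $$Var(C_k)=\frac{2(1+j)^{k+2}(I\ddot s)_{\overline{k}|r}-2(1+j)(I\ddot s)_{\overline{k}|f}-j(2+j)(I^2\ddot s)_{\overline{k}|f}}{j^2}-\frac{(I\ddot s)_{\overline{2k}|j}-2(1+kd)(I\ddot s)_{\overline{k}|j}-k^2}{d^2}.$$
   Context: Final value: for annual payments $c_1,c_2,\dots$ the final value is defined by $C_1=(1+i_1)c_1$ and $C_k=(1+i_k)(C_{k-1}+c_k)$ for $k\ge 2$; here $c_l=l$. For a positive integer $k$ and real $x$: $(I\ddot s)_{\overline{k}|x}=\sum_{l=1}^k l(1+x)^{k+1-l}$, $(I^2\ddot s)_{\overline{k}|x}=\sum_{l=1}^k l^2(1+x)^{k+1-l}$. Constants: $d=j/(1+j)$, $f=2j+j^2+s^2$ (so $1+f=E[(1+i_l)^2]$), and $r$ is defined by $1+r=(1+f)/(1+j)$. *)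

(* Defs.v *)
From HB Require Import structures.
From mathcomp Require Export all_boot all_order all_algebra.
From mathcomp Require Export all_classical all_reals all_analysis.

Set Implicit Arguments.
Unset Strict Implicit.
Unset Printing Implicit Defensive.

Import Order.TTheory GRing.Theory Num.Theory.

Local Open Scope classical_set_scope.
Local Open Scope ring_scope.

Definition mutually_independent (disp : measure_display)
    (T : measurableType disp) (R : realType) (P : probability T R)
    (I : finType) (X : I -> {RV P >-> R}) : Prop :=
  forall (J : {set I}) (B : I -> set R),
    (forall l, measurable (B l)) ->
    P (\bigcap_(l in [set` J]) (X l @^-1` B l)) =
      (\prod_(l in J) P (X l @^-1` B l))%E.

(* [x l] is the interest rate of year [l] and [c l] the payment made at the
   beginning of year [l], for [l >= 1]; entries at index [0] are never read. *)
Fixpoint final_value (R : realType) (x c : nat -> R) (k : nat) : R :=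
  match k with
  | 0 => 0
  | 1 => (1 + x 1%N) * c 1%N
  | k'.+1 => (1 + x k) * (final_value x c k' + c k)
  end.

Definition final_value_inc (disp : measure_display)
    (T : measurableType disp) (R : realType) (P : probability T R)
    (i : nat -> {RV P >-> R}) (k : nat) : T -> R :=
  fun w => final_value (fun l => i l w) (fun l => l%:R) k.

(* The actuarial symbols (I s-double-dot) and (I^2 s-double-dot) of term [k] at
   rate [x]. *)
Definition Isdd (R : realType) (k : nat) (x : R) : R :=
  \sum_(1 <= l < k.+1) l%:R * (1 + x) ^+ (k + 1 - l).

Definition I2sdd (R : realType) (k : nat) (x : R) : R :=
  \sum_(1 <= l < k.+1) l%:R ^+ 2 * (1 + x) ^+ (k + 1 - l).

(* Main.v *)
(* The final value satisfies [C_k = (1 + i_k) (C_(k-1) + k)] with [i_k] independent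
   of [C_(k-1)], so that [E(C_k) = (1 + j) (E(C_(k-1)) + k)] and
   [E(C_k^2) = (1 + f) (E(C_(k-1)^2) + 2 k E(C_(k-1)) + k^2)]. The first recursion
   is that of [Isdd k j], whose closed form
   [j^2 Isdd k j = (1 + j) ((1 + j)^(k+1) - 1 - (k + 1) j)] shows both that the
   first fraction of the variance formula solves the second recursion and that
   the second fraction equals [(Isdd k j)^2]. *)
From HB Require Import structures.
Require Import Defs.
From mathcomp Require Import all_boot all_order all_algebra ring.
From mathcomp Require Import all_classical all_reals all_analysis.
From mathcomp Require Import measurable_realfun.

Import Order.TTheory GRing.Theory Num.Theory.

Local Open Scope classical_set_scope.
Local Open Scope ring_scope.

Set Implicit Arguments.
Unset Strict Implicit.

(** * Recursions and closed forms of the annuity sums *)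

Lemma final_valueS (R : realType) (x c : nat -> R) (k : nat) :
  final_value x c k.+1 = (1 + x k.+1) * (final_value x c k + c k.+1).
Proof. by case: k => //=; rewrite add0r. Qed.

Lemma sum_nat_exp_rec (R : realType) (a : nat -> R) (k : nat) (y : R) :
  \sum_(1 <= l < k.+2) a l * y ^+ (k.+1 + 1 - l) =
  y * (\sum_(1 <= l < k.+1) a l * y ^+ (k + 1 - l) + a k.+1).
Proof.
rewrite big_nat_recr//= addn1 subSn// subnn expr1 mulrDr mulr_sumr [a _ * _]mulrC.
congr (_ + _); apply: eq_big_nat => l /andP[_ lk].
by rewrite addn1 subSn 1?ltnW// exprS mulrCA.
Qed.

Lemma Isdd0 (R : realType) (x : R) : Isdd 0 x = 0.
Proof. by rewrite /Isdd big_geq. Qed.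

Lemma IsddS (R : realType) (k : nat) (x : R) :
  Isdd k.+1 x = (1 + x) * (Isdd k x + k.+1%:R).
Proof. exact: sum_nat_exp_rec. Qed.

Lemma I2sddS (R : realType) (k : nat) (x : R) :
  I2sdd k.+1 x = (1 + x) * (I2sdd k x + k.+1%:R ^+ 2).
Proof. exact: (sum_nat_exp_rec (fun l => l%:R ^+ 2)). Qed.

Lemma Isdd_closed (R : realType) (k : nat) (j : R) :
  j ^+ 2 * Isdd k j = (1 + j) * ((1 + j) ^+ k.+1 - 1 - k.+1%:R * j).
Proof.
elim: k => [|k IH]; first by rewrite Isdd0; ring.
rewrite IsddS mulrCA mulrDr IH !exprS -!natr1; ring.
Qed.

(* The recursion for [E(C_k^2)], where [q = E((1 + i_l)^2)] and [Isdd k j] is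
   [E(C_k)]. *)
Fixpoint sq_moment {R : realType} (q j : R) (k : nat) : R :=
  match k with
  | 0 => 0
  | k'.+1 => q * (sq_moment q j k' + k%:R *+ 2 * Isdd k' j + k%:R ^+ 2)
  end.

(** With K = k + 1, the closed form of [Isdd k j] turns the forcing term 2 K j^2 [Isdd k j] + K^2
    j^2 into 2 (1 + j)^(K+1) K - 2 (1 + j) K - j (2 + j) K^2, one summand for each of the three
    sums. The growing power of 1 + j is absorbed by passing from rate f to rate r, since (1 + j) (1
    + r) = 1 + f. *)
Lemma sq_moment_closed (R : realType) (j f r : R) (k : nat) :
  j != 0 -> (1 + r) * (1 + j) = 1 + f ->
  sq_moment (1 + f) j k =
    (2 * (1 + j) ^+ (k + 2) * Isdd k r - 2 * (1 + j) * Isdd k f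
      - j * (2 + j) * I2sdd k f) / j ^+ 2.
Proof.
move=> j0 rf; apply: (canRL (mulfK _)); first by rewrite expf_neq0.
rewrite mulrC; elim: k => [|k IH].
  by rewrite !Isdd0 /I2sdd big_geq//=; ring.
rewrite /= !IsddS I2sddS; set K := k.+1%:R.
have E := Isdd_closed k j.
(* The factor j^2 is distributed so that the left-hand sides of [IH] and [E] appear literally. *)
transitivity ((1 + f) * (j ^+ 2 * sq_moment (1 + f) j k
    + K *+ 2 * (j ^+ 2 * Isdd k j) + K ^+ 2 * j ^+ 2)); first by ring.
rewrite IH E -rf addSn !addn2 -/K !exprS; ring.
Qed.

Lemma Isdd_sqr (R : realType) (j : R) (k : nat) : j != 0 -> 1 + j != 0 ->
  (Isdd (2 * k) j - 2 * (1 + k%:R * (j / (1 + j))) * Isdd k j - k%:R ^+ 2)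
    / (j / (1 + j)) ^+ 2 = Isdd k j ^+ 2.
Proof.
move=> j0 j1.
have cl m : Isdd m j = (1 + j) * ((1 + j) ^+ m.+1 - 1 - m.+1%:R * j) / j ^+ 2.
  by rewrite -Isdd_closed mulrC mulKf ?expf_neq0.
(* The power of exponent 2k is the square of [X] below, so the claim becomes an identity of rational
   functions in j, k and [X]. *)
rewrite !cl [_ ^+ (2 * k).+1]exprS mulnC exprM [_ ^+ k.+1]exprS -!natr1 natrM.
set X := (1 + j) ^+ k; field.
by rewrite j0 j1.
Qed.

(** * Independence of two variables and moments of their product *)

Section independence.
Context (disp : measure_display) (T : measurableType disp) (R : realType)
  (P : probability T R).
Implicit Types X Y : {RV P >-> R}.

(** Stated for plain functions, so that composites and shifts need not be bundled as random
    variables. *)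
Definition indep2 (X Y : T -> R) :=
  forall A B : set R, measurable A -> measurable B ->
  P (X @^-1` A `&` Y @^-1` B) = (P (X @^-1` A) * P (Y @^-1` B))%E.

Lemma indep2_comp (X Y : T -> R) (g h : R -> R) :
  measurable_fun [set: R] g -> measurable_fun [set: R] h ->
  indep2 X Y -> indep2 (g \o X) (h \o Y).
Proof.
move=> mg mh XY A B mA mB.
have mgA : measurable (g @^-1` A).
  by rewrite -[X in measurable X]setTI; exact: mg.
have mhB : measurable (h @^-1` B).
  by rewrite -[X in measurable X]setTI; exact: mh.
exact: XY mgA mhB.
Qed.

Definition pairRV X Y : T -> R * R := fun w => (X w, Y w).

Lemma measurable_pairRV X Y : measurable_fun [set: T] (pairRV X Y).
Proof. exact: measurable_fun_pair. Qed.

HB.instance Definition _ X Y :=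
  isMeasurableFun.Build _ _ _ _ (pairRV X Y) (measurable_pairRV X Y).

(** Independence is agreement of the joint law with the product of the laws on rectangles, and this
    determines the product measure. *)
Lemma indep2_distribution X Y (D : set (R * R)) : indep2 X Y -> measurable D ->
  (distribution P X \x distribution P Y)%E D = distribution P (pairRV X Y) D.
Proof.
move=> XY mD; exact: product_measure_unique.
Qed.

(* Both sides, as functions of [D], are measures on the plane that agree with
   [(P E *: law of X) \x (law of Y)] on rectangles. *)
Lemma indep_event_comp2 X Y (E : set T) (D : set (R * R)) :
  measurable E -> measurable D -> indep2 X Y ->
  (forall A B, measurable A -> measurable B ->
    P ((X @^-1` A `&` Y @^-1` B) `&` E) =
    (P (X @^-1` A) * P (Y @^-1` B) * P E)%E) ->
  P (pairRV X Y @^-1` D `&` E) = (P (pairRV X Y @^-1` D) * P E)%E.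
Proof.
move=> mE mD XY ind.
(* [mscale] takes a nonnegative real, so the probability of [E] is first turned into one. *)
have [c Pc] : exists c : {nonneg R}, c%:num%:E = P E.
  exists (NngNum (fine_ge0 (measure_ge0 P E))).
  by rewrite /= fineK// fin_num_measure.
pose m1 := mscale c (distribution P X).
pose m3 := mscale c (distribution P (pairRV X Y)).
transitivity ((m1 \x distribution P Y)%E D).
  symmetry.
  apply: (@product_measure_unique _ _ _ _ _ m1 (distribution P Y)
    (pushforward (mrestr P mE) (pairRV X Y))) => // A B mA mB.
  transitivity (P (X @^-1` A) * P (Y @^-1` B) * P E)%E; first exact: ind.
  by rewrite [RHS]/= /mscale Pc muleC muleA.
transitivity (m3 D).
  apply: (@product_measure_unique _ _ _ _ _ m1 (distribution P Y) m3)
    => // A B mA mB.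
  rewrite [LHS]/= [RHS]/= /mscale Pc -muleA; congr (_ * _)%E.
  exact: XY.
by rewrite -Pc muleC.
Qed.

(** The product is (x, y) |-> x y under the joint law, which is the product of the laws: Tonelli
    gives integrability, Fubini the factorisation. *)
Lemma indep2_prodRV X Y : indep2 X Y ->
  (X : T -> R) \in Lfun P 1 -> (Y : T -> R) \in Lfun P 1 ->
  ((X \* Y)%R : T -> R) \in Lfun P 1 /\ 'E_P[X \* Y]%E = ('E_P[X] * 'E_P[Y])%E.
Proof.
move=> XY /Lfun1_integrable iX /Lfun1_integrable iY.
pose f (z : R * R) : \bar R := (z.1 * z.2)%:E.
have mf : measurable_fun setT f.
  by apply/measurable_EFinP; apply: measurable_funM.
pose m1 := distribution P X; pose m2 := distribution P Y.
have i1 : m1.-integrable setT (@EFin R).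
  by apply: integrable_pushforward.
have i2 : m2.-integrable setT (@EFin R).
  by apply: integrable_pushforward.
have iF : (m1 \x m2)%E.-integrable setT f.
  apply/integrable12ltyP => //.
  have nE (mu : probability R R) (z : R) :
      (\int[mu]_y `|(z * y)%:E| = `|z|%:E * \int[mu]_y `|y%:E|)%E.
    under eq_integral => y _ do rewrite EFinM abseM.
    by rewrite ge0_integralZl//; apply: measurableT_comp.
  under eq_integral => x _ do rewrite (nE m2).
  rewrite ge0_integralZr ?integral_ge0//; last exact: measurableT_comp.
  move: i1 i2 => /integrableP[_ i1] /integrableP[_ i2].
  by rewrite lte_mul_pinfty ?ge0_fin_numE ?integral_ge0.
have iP : P.-integrable setT (f \o pairRV X Y).
  apply/integrableP; split; first exact: measurableT_comp.
  move/integrableP: iF => [_]; apply: le_lt_trans.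
  rewrite le_eqVlt; apply/orP; left; apply/eqP.
  rewrite (eq_measure_integral (distribution P (pairRV X Y))).
    rewrite (ge0_integral_distribution (pairRV X Y : {RV P >-> (R * R)%type}))//.
    exact: measurableT_comp.
  by move=> A mA _; exact: indep2_distribution.
split; first exact/Lfun1_integrable.
rewrite unlock.
transitivity (\int[P]_w (f \o pairRV X Y) w)%E => //.
rewrite -integral_distribution//.
rewrite (eq_measure_integral (m1 \x m2)%E); last first.
  by move=> A mA _; symmetry; exact: indep2_distribution.
rewrite -integral12_prod_meas1//=.
have nE (z : R) : (\int[m2]_y (z * y)%:E = z%:E * \int[m2]_y y%:E)%E.
  by under eq_integral => y _ do rewrite EFinM; rewrite integralZl.
transitivity (\int[m1]_x (x%:E * \int[m2]_y y%:E))%E.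
  by apply: eq_integral => x _; exact: nE.
have E2 : (\int[m2]_y y%:E = \int[P]_w (Y w)%:E)%E.
  exact: (@integral_distribution _ _ _ _ _ P Y (@EFin R) _ iY).
have <- : (\int[m1]_y y%:E = \int[P]_w (X w)%:E)%E.
  exact: (@integral_distribution _ _ _ _ _ P X (@EFin R) _ iX).
have /fineK fY : (\int[m2]_y y%:E)%E \is a fin_num.
  exact: integrable_fin_num.
by rewrite -E2 -fY integralZr.
Qed.

(** Membership in [Lfun] carries measurability, which allows bundling. *)
Lemma indep2_prod (X Y : T -> R) : indep2 X Y ->
  X \in Lfun P 1 -> Y \in Lfun P 1 ->
  X \* Y \in Lfun P 1 /\ 'E_P[X \* Y]%E = ('E_P[X] * 'E_P[Y])%E.
Proof.
move=> XY X1 Y1.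
exact: (@indep2_prodRV (mfun_Sub (sub_Lfun_mfun X1))
  (mfun_Sub (sub_Lfun_mfun Y1))).
Qed.

Lemma Lfun2_sqr (X : T -> R) : measurable_fun [set: T] X ->
  (fun w => X w ^+ 2) \in Lfun P 1 -> X \in Lfun P 2%:E.
Proof.
move=> mX /Lfun1_integrable /integrableP[_ iX].
rewrite inE; apply/andP; split; rewrite inE//=.
rewrite /finite_norm unlock poweR_lty//=.
apply: le_lt_trans iX; rewrite le_eqVlt; apply/orP; left; apply/eqP.
apply: eq_integral => w _ /=.
by rewrite powR_mulrn// normrX.
Qed.

Lemma Lfun1_sqr (X : T -> R) : X \in Lfun P 2%:E ->
  (fun w => X w ^+ 2) \in Lfun P 1.
Proof. by move=> /Lfun2_integrable_sqr /Lfun1_integrable. Qed.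

Lemma indep2_prod_sqr (X Y : T -> R) : indep2 X Y ->
  X \in Lfun P 2%:E -> Y \in Lfun P 2%:E ->
  X \* Y \in Lfun P 2%:E /\
  'E_P[fun w => ((X w * Y w) ^+ 2)%R]%E =
    ('E_P[fun w => (X w ^+ 2)%R] * 'E_P[fun w => (Y w ^+ 2)%R])%E.
Proof.
move=> XY X2 Y2.
have sqr : measurable_fun [set: R] (fun x : R => x ^+ 2).
  exact: measurable_funX.
have [XY1 EXY] :=
  indep2_prod (indep2_comp sqr sqr XY) (Lfun1_sqr X2) (Lfun1_sqr Y2).
have XYE : (fun w => (X w * Y w) ^+ 2) =
    ((fun x => x ^+ 2) \o X) \* ((fun x => x ^+ 2) \o Y).
  by apply/funext => w /=; rewrite exprMn.
split; last by rewrite XYE.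
apply: Lfun2_sqr; last by rewrite XYE.
by apply: measurable_funM; apply/set_mem; apply: sub_Lfun_mfun; eassumption.
Qed.

(** Square integrability comes from the variance itself: the integral of the nonnegative (X - m)^2
    is the real number v, so X - m is in L^2, and so is X after adding a constant. *)
Lemma Lfun2_of_variance (X : T -> R) (m v : R) : measurable_fun [set: T] X ->
  'E_P[X]%E = m%:E -> 'V_P[X]%E = v%:E ->
  X \in Lfun P 2%:E /\ 'E_P[fun w => (X w ^+ 2)%R]%E = (v + m ^+ 2)%:E.
Proof.
move=> mX EX VX.
have mXm : measurable_fun [set: T] (X \- cst m) by exact: measurable_funB.
have Xm2 : X \- cst m \in Lfun P 2%:E.
  apply: Lfun2_sqr => //; apply/Lfun1_integrable/integrableP; split.
    by apply/measurable_EFinP; exact: measurable_funX.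
  have : (v%:E < +oo)%E by exact: ltry.
  rewrite -VX /variance unlock EX/= unlock; apply: le_lt_trans.
  rewrite le_eqVlt; apply/orP; left; apply/eqP; apply: eq_integral => w _ /=.
  by rewrite ger0_norm ?sqr_ge0// -expr2.
have X2 : X \in Lfun P 2%:E.
  have -> : X = (X \- cst m) + cst m by apply/funext => w /=; rewrite subrK.
  by rewrite rpredD ?lee1n// => H; exact: Lfun_cst.
split=> //.
have := varianceE X2; rewrite VX EX (_ : X ^+ 2 = fun w => X w ^+ 2)//.
rewrite -(fineK (expectation_fin_num (Lfun1_sqr X2))) -EFin_expe -EFinB.
by move=> [->]; rewrite subrK.
Qed.

Lemma expectation_shift (X : T -> R) (c m : R) : X \in Lfun P 1 ->
  'E_P[X]%E = m%:E -> 'E_P[fun w => (X w + c)%R]%E = (m + c)%:E.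
Proof.
move=> X1 EX.
rewrite (_ : (fun w => X w + c) = X \+ cst c)//.
by rewrite expectationD ?Lfun_cst// EX expectation_cst.
Qed.

Lemma expectation_shift_sqr (X : T -> R) (c m q : R) : X \in Lfun P 2%:E ->
  'E_P[X]%E = m%:E -> 'E_P[fun w => (X w ^+ 2)%R]%E = q%:E ->
  'E_P[fun w => ((X w + c) ^+ 2)%R]%E = (q + c *+ 2 * m + c ^+ 2)%:E.
Proof.
move=> X2 EX EXX.
have X1 : X \in Lfun P 1 by apply: Lfun_subset12 => //; exact: fin_num_measure.
rewrite (_ : (fun w => (X w + c) ^+ 2) =
    ((fun w => X w ^+ 2) \+ (c *+ 2) \o* X) \+ cst (c ^+ 2)).
  by rewrite !expectationD ?expectationZl ?expectation_cst ?EX ?EXX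
    ?rpredD ?Lfun_cst ?Lfun_scale ?Lfun1_sqr.
by apply/funext => w /=; rewrite sqrrD -mulrnAr.
Qed.

End independence.

(** * Independence and moments of the final value *)

Lemma measurable_final_value_inc (disp : measure_display)
    (T : measurableType disp) (R : realType) (P : probability T R)
    (i : nat -> {RV P >-> R}) (k : nat) :
  measurable_fun [set: T] (final_value_inc i k).
Proof.
elim: k => [|k IH]; first exact: measurable_cst.
rewrite /final_value_inc; under eq_fun do rewrite final_valueS.
by apply: measurable_funM; apply: measurable_funD.
Qed.

Lemma bigcap_setU1_fin (T : Type) (I : finType) (F : I -> set T) (x : I)
    (J : {set I}) :
  \bigcap_(l in [set` (x |: J)%SET]) F l = F x `&` \bigcap_(l in [set` J]) F l.
Proof.
apply/seteqP; split=> w /=.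
  move=> H; split; first by apply: H; rewrite /= setU11.
  by move=> l /= lJ; apply: H; rewrite /= in_setU1 lJ orbT.
move=> [Hx HJ] l /=; rewrite in_setU1 => /orP[/eqP->//|lJ].
exact: HJ.
Qed.

Lemma bigcap_set1_fin (T : Type) (I : finType) (F : I -> set T) (x : I) :
  \bigcap_(l in [set` [set x]%SET]) F l = F x.
Proof.
apply/seteqP; split=> w /= => [|Fx l /=]; last by rewrite inE => /eqP ->.
by apply; rewrite /= set11.
Qed.

(* The final value after [k] years is independent of the rates of all later
   years; this joint form is what makes the induction on [k] go through. *)
Lemma final_value_inc_indep (disp : measure_display)
    (T : measurableType disp) (R : realType) (P : probability T R)
    (n : nat) (i : nat -> {RV P >-> R})
    (i_indep : mutually_independent (fun l : 'I_n => i l.+1)) (k : nat) :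
  (k <= n)%N ->
  forall (J : {set 'I_n}) (A : set R) (B : 'I_n -> set R),
  (forall l, l \in J -> (k <= l)%N) -> measurable A ->
  (forall l, measurable (B l)) ->
  P (final_value_inc i k @^-1` A `&`
     \bigcap_(l in [set` J]) (i l.+1 @^-1` B l)) =
  (P (final_value_inc i k @^-1` A) * \prod_(l in J) P (i l.+1 @^-1` B l))%E.
Proof.
elim: k => [_|k IH kn] J A B kJ mA mB.
  rewrite (_ : final_value_inc i 0 = cst 0)// preimage_cst.
  case: ifPn => _; last by rewrite set0I measure0 mul0e.
  by rewrite setTI probability_setT mul1e -(i_indep J B mB).
(* An index l of ['I_n] stands for year l + 1, so [lk], of value k, is year k + 1, and k <= l means
   a year after year k. *)
pose lk := Ordinal kn.
pose Y := i k.+1.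
have lkJ : lk \notin J by apply/negP => /kJ; rewrite ltnn.
have JP l : l \in J -> (k <= l)%N by move=> /kJ /ltnW.
have IH1 := IH (ltnW kn).
pose C : {RV P >-> R} :=
  mfun_Sub (mem_set (measurable_final_value_inc i k)).
have CY : indep2 P C Y.
  move=> A' B' mA' mB'.
  have := IH1 [set lk]%SET A' (fun=> B').
  rewrite big_set1 bigcap_set1_fin; apply => //.
  by move=> l; rewrite inE => /eqP ->.
pose E := \bigcap_(l in [set` J]) (i l.+1 @^-1` B l).
have mE : measurable E.
  apply: fin_bigcap_measurable => // l _.
  by rewrite -[X in measurable X]setTI; exact: measurable_funP.
have PE : P E = (\prod_(l in J) P (i l.+1 @^-1` B l))%E by exact: i_indep.
(* One step of the recursion: an event on the next final value is a planar event on the pair ([C],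
   [Y]). *)
pose h (z : R * R) := (1 + z.2) * (z.1 + k.+1%:R).
have mh : measurable_fun setT h.
  by apply: measurable_funM; apply: measurable_funD.
have mD : measurable (h @^-1` A) by rewrite -[X in measurable X]setTI; exact: mh.
have CE : final_value_inc i k.+1 @^-1` A = pairRV C Y @^-1` (h @^-1` A).
  by rewrite /final_value_inc; under eq_fun do rewrite final_valueS.
rewrite -PE CE; apply: indep_event_comp2 => // A' B' mA' mB'.
(* The event on year k + 1 joins those on the later years in one family over [lk |: J], to which the
   induction hypothesis applies. *)
pose B2 (l : 'I_n) := if l == lk then B' else B l.
have B2J l : l \in J -> B2 l = B l.
  by move=> lJ; rewrite /B2; case: eqP lkJ => // <-; rewrite lJ.
have EB : \bigcap_(l in [set` J]) (i l.+1 @^-1` B2 l) =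
    \bigcap_(l in [set` J]) (i l.+1 @^-1` B l).
  by apply: eq_bigcapr => l /= lJ; rewrite B2J.
have PB : (\prod_(l in J) P (i l.+1 @^-1` B2 l) =
    \prod_(l in J) P (i l.+1 @^-1` B l))%E.
  by apply: eq_bigr => l lJ; rewrite B2J.
have B2lk : B2 lk = B' by rewrite /B2 eqxx.
rewrite -setIA -muleA PE -PB -EB -[in LHS]B2lk -[in RHS]B2lk.
rewrite -(bigcap_setU1_fin (fun l : 'I_n => i l.+1 @^-1` B2 l)).
have -> : (P (Y @^-1` B2 lk) * \prod_(l in J) P (i l.+1 @^-1` B2 l) =
    \prod_(l in (lk |: J)%SET) P (i l.+1 @^-1` B2 l))%E by rewrite big_setU1.
apply: IH1 => // l.
  by rewrite in_setU1 => /orP[/eqP ->//|/JP].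
by rewrite /B2; case: ifP.
Qed.

(** The three claims are proved together: the second moment recursion uses the mean, and the product
    rules need membership in L^2. *)
Lemma final_value_inc_moments (disp : measure_display)
    (T : measurableType disp) (R : realType) (P : probability T R)
    (n : nat) (i : nat -> {RV P >-> R}) (j v : R)
    (i_indep : mutually_independent (fun l : 'I_n => i l.+1))
    (i_mean : forall l : nat, (1 <= l <= n)%N ->
      ('E_P[fun w => (1 + i l w)%R] = (1 + j)%:E)%E)
    (i_var : forall l : nat, (1 <= l <= n)%N ->
      ('V_P[fun w => (1 + i l w)%R] = v%:E)%E) (k : nat) :
  (k <= n)%N ->
  [/\ final_value_inc i k \in Lfun P 2%:E,
      'E_P[final_value_inc i k]%E = (Isdd k j)%:E &
      'E_P[fun w => (final_value_inc i k w ^+ 2)%R]%E =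
        (sq_moment (v + (1 + j) ^+ 2) j k)%:E].
Proof.
elim: k => [_|k IH kn].
  rewrite (_ : final_value_inc i 0 = cst 0)// Isdd0 /= expectation_cst.
  split=> //; first exact: Lfun_cst.
  rewrite -[RHS](expectation_cst P); congr expectation.
  by apply/funext => w /=; rewrite expr0n.
have [C2 EC ECC] := IH (ltnW kn).
have C1 : final_value_inc i k \in Lfun P 1.
  by apply: Lfun_subset12 => //; exact: fin_num_measure.
pose c : R := k.+1%:R.
pose X w := 1 + i k.+1 w.
pose Y w := final_value_inc i k w + c.
have mX : measurable_fun [set: T] X by exact: measurable_funD.
have [X2 EXX] := Lfun2_of_variance mX (i_mean k.+1 kn) (i_var k.+1 kn).
have X1 : X \in Lfun P 1 by apply: Lfun_subset12 => //; exact: fin_num_measure.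
have Y2 : Y \in Lfun P 2%:E.
  rewrite (_ : Y = final_value_inc i k \+ cst c)//.
  by rewrite rpredD ?lee1n// => H; exact: Lfun_cst.
have Y1 : Y \in Lfun P 1 by apply: Lfun_subset12 => //; exact: fin_num_measure.
(* [X] depends only on the rate of year k + 1 and [Y] only on the final value after k years. *)
have CX : indep2 P X Y.
  apply: (@indep2_comp _ _ _ P (i k.+1) (final_value_inc i k)
    (fun x => 1 + x) (fun x => x + c)).
  - exact: measurable_funD.
  - exact: measurable_funD.
  - move=> A B mA mB.
    have := @final_value_inc_indep _ _ _ _ _ _ i_indep k (ltnW kn)
      [set Ordinal kn]%SET B (fun=> A).
    rewrite big_set1 bigcap_set1_fin setIC muleC; apply => //.
    by move=> l; rewrite inE => /eqP ->.
have CS : final_value_inc i k.+1 = X \* Y.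
  by apply/funext => w; rewrite /final_value_inc final_valueS.
have [_ EXY] := indep2_prod CX X1 Y1.
have [XY2 EXYXY] := indep2_prod_sqr CX X2 Y2.
rewrite CS; split=> //.
  by rewrite EXY (i_mean k.+1 kn) (expectation_shift c C1 EC) -EFinM IsddS.
by rewrite EXYXY EXX (expectation_shift_sqr c C2 EC ECC) -EFinM.
Qed.

Unset Implicit Arguments.
Set Strict Implicit.

Theorem corollary3p3 (disp : measure_display) (T : measurableType disp)
    (R : realType) (P : probability T R)
    (n : nat) (n_ge1 : (1 <= n)%N)
    (* the rates are i 1, ..., i n; no hypothesis is made on the other indices *)
    (i : nat -> {RV P >-> R}) (j s d f r : R)
    (i_indep : mutually_independent (fun l : 'I_n => i l.+1))
    (i_mean : forall l : nat, (1 <= l <= n)%N ->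
      ('E_P[fun w => (1 + i l w)%R] = (1 + j)%:E)%E)
    (i_var : forall l : nat, (1 <= l <= n)%N ->
      ('V_P[fun w => (1 + i l w)%R] = (s ^+ 2)%:E)%E)
    (j_neq0 : j != 0) (j_neqN1 : j != -1)
    (d_def : d = j / (1 + j))
    (f_def : f = 2 * j + j ^+ 2 + s ^+ 2)
    (r_def : 1 + r = (1 + f) / (1 + j))
    (k : nat) (k_range : (1 <= k <= n)%N) :
  ('E_P[final_value_inc i k] = (Isdd k j)%:E)%E /\
  ('V_P[final_value_inc i k] =
     ((2 * (1 + j) ^+ (k + 2) * Isdd k r
         - 2 * (1 + j) * Isdd k f
         - j * (2 + j) * I2sdd k f) / j ^+ 2
      - (Isdd (2 * k) j
         - 2 * (1 + k%:R * d) * Isdd k j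
         - k%:R ^+ 2) / d ^+ 2)%:E)%E.
Proof.
have [k1 kn] := andP k_range.
(* This identifies 1 + f with the second moment of 1 + i_l, the factor in [sq_moment]. *)
have fE : 1 + f = s ^+ 2 + (1 + j) ^+ 2 by rewrite f_def; ring.
have j1 : 1 + j != 0 by rewrite addrC addr_eq0.
have rf : (1 + r) * (1 + j) = 1 + f by rewrite r_def divfK.
have [C2 EC ECC] :=
  final_value_inc_moments i_indep i_mean i_var kn.
split=> //; rewrite varianceE// EC
  (_ : _ ^+ 2 = fun w => final_value_inc i k w ^+ 2)//.
by rewrite ECC -fE (sq_moment_closed _ j_neq0 rf) d_def Isdd_sqr.
Qed.
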